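(* There exists a linear-time algorithm for computing the edge open packing number of a tree; that is, there is an algorithm which, given a tree $T$ on $n$ vertices, outputs $\rho_e^o(T)$ in $O(n)$ time.
   Context: All graphs are finite and simple. A set $B\subseteq E(G)$ is an edge open packing set (EOP set) of $G$ if for every two distinct edges $e_1,e_2\in B$ there is no edge $e\in E(G)\setminus\{e_1,e_2\}$ joining an endvertex of $e_1$ to an endvertex of $e_2$ (i.e. there is no edge $e$ such that $e_1,e,e_2$ form a path with $e$ in the middle or a triangle). Two edges of $B$ are allowed to share an endvertex. The edge open packing number $\rho_e^o(G)$ is the maximum cardinality of an EOP set of $G$. Running time is measured in the usual model in which adding and comparing two numbers takes $O(1)$ time. *)

(* Defs.v *)
From HB Require Import structures.
From mathcomp Require Import all_boot.

Set Implicit Arguments.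
Unset Strict Implicit.
Unset Printing Implicit Defensive.

Record sgraph (V : finType) := SGraph {
  adj :> rel V;
  adj_sym : symmetric adj;
  adj_irrefl : irreflexive adj
}.

Section Graphs.

Variables (V : finType) (G : sgraph V).

Definition edges : {set {set V}} :=
  [set [set p.1; p.2] | p : V * V & G p.1 p.2].

(* [ucycle G c] accepts [:: x; y] for every edge xy, hence the bound 2;
   longer duplicate-free cyclic sequences are exactly the cycles of G. *)
Definition acyclic : Prop := forall c : seq V, ucycle G c -> size c <= 2.

Definition is_tree : Prop :=
  [/\ 0 < #|V|, forall x y : V, connect G x y & acyclic].

Definition joins (e e1 e2 : {set V}) : bool :=
  [exists x in e1, exists y in e2, e == [set x; y]].

Definition eop_set (B : {set {set V}}) : bool :=
  (B \subset edges) &&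
  [forall e1 in B, forall e2 in B, (e1 != e2) ==>
     ~~ [exists e in edges :\: [set e1; e2], joins e e1 e2]].

Definition eop_number : nat := \max_(B : {set {set V}} | eop_set B) #|B|.

(* Every edge is listed exactly once, in an arbitrary order and with its
   endvertices in an arbitrary order. *)
Definition edge_list (l : seq (V * V)) : Prop :=
  perm_eq [seq [set uv.1; uv.2] | uv <- l] (enum edges).

End Graphs.

(* Random access machine with unit-cost instructions. The state has a program
   counter, a register file and a memory, all holding natural numbers. Since a
   program is a finite list and register names are literals in it, a program
   uses finitely many registers; only the memory is addressed indirectly. *)

Inductive instr : Type :=
| IConst of nat & nat        (* IConst r k    : r := k                      *)
| IAdd of nat & nat & nat    (* IAdd r s t    : r := s + t                  *)
| ISub of nat & nat & nat    (* ISub r s t    : r := s - t, truncated at 0  *)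
| IRead of nat & nat         (* IRead r s     : r := memory[s]              *)
| IWrite of nat & nat        (* IWrite r s    : memory[r] := s              *)
| IJumpLe of nat & nat & nat (* IJumpLe r s q : if r <= s then go to line q *)
| IHalt.

Definition program := seq instr.

Record config := Config {
  pc : nat;
  reg : nat -> nat;
  memory : nat -> nat
}.

(* Running past the last line of the program counts as halting. *)
Definition fetch (P : program) (c : config) : instr := nth IHalt P (pc c).

Definition set_reg (c : config) (r v : nat) : config :=
  Config (pc c).+1 [eta reg c with r |-> v] (memory c).

Definition step (P : program) (c : config) : config :=
  match fetch P c with
  | IConst r k => set_reg c r k
  | IAdd r s t => set_reg c r (reg c s + reg c t)
  | ISub r s t => set_reg c r (reg c s - reg c t)
  | IRead r s => set_reg c r (memory c (reg c s))
  | IWrite r s => Config (pc c).+1 (reg c) [eta memory c with reg c r |-> reg c s]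
  | IJumpLe r s q =>
      Config (if reg c r <= reg c s then q else (pc c).+1) (reg c) (memory c)
  | IHalt => c
  end.

Definition halted (P : program) (c : config) : bool :=
  if fetch P c is IHalt then true else false.

(* The input word is in memory from address 0 on; everything else is 0. *)
Definition init (w : seq nat) : config :=
  Config 0 (fun=> 0) (fun a => nth 0 w a).

(* On input w, P halts after executing at most t instructions, with output k
   in register 0. A halted configuration is a fixed point of [step], so the
   configuration after exactly t steps decides this. *)
Definition outputs_within (P : program) (w : seq nat) (t k : nat) : Prop :=
  let c := iter t (step P) (init w) in halted P c /\ reg c 0 = k.

(* The word n, u_1, v_1, u_2, v_2, etc., for the edges u_i v_i in l. *)
Definition encode (n : nat) (l : seq ('I_n * 'I_n)) : seq nat :=
  n :: flatten [seq [:: val uv.1; val uv.2] | uv <- l].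

(* Main.v *)
Require Import Defs.
From mathcomp Require Import all_boot zify.

(** An edge open packing is the edge set of an induced star forest: an edge of
    the graph between two of its vertices belongs to it, and it contains no path
    of three edges. Choosing a centre in each star turns it into a colouring of
    the vertices as centre, leaf or outside, in which adjacent coloured vertices
    are a centre and a leaf and no leaf has two centres. The size of the packing
    becomes the number of adjacent centre-leaf pairs, so the edge open packing
    number is the maximal weight of such a colouring ([star_of_eop],
    [eop_spokes], [eop_number_root]).

    On a tree this maximum is computed by dynamic programming. For a block [D] of
    vertices with a root [r], the table of [r] records the best weight on [D] for
    each role of [r]: outside, centre, leaf without a centre in [D], leaf. If the
    only edge between two blocks joins their roots, the table of the union
    follows from the two tables in constant time ([optima_bridge]).

    The tree comes as an unordered list of edges, so the program prunes it rather
    than traverses it. Each vertex holds its degree and the sum of the addresses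
    of its neighbours; for a leaf this sum is the address of its only
    neighbour, so no adjacency lists are required, and removing a leaf means two
    subtractions. The vertices are scanned once. As long as the current vertex
    is a leaf, its block is merged into that of its neighbour, it is removed, and
    the neighbour becomes current. A vertex is removed at most once, so this takes
    linear time. A vertex that the scan has passed can become a leaf only by
    losing a neighbour, and is then current at once; thus no leaf is left at
    the end of the scan. A finite acyclic graph without leaves has no edges
    ([exists_leaf]), so by connectedness a single block is left and it contains
    all vertices ([contraction_done]). Its table gives the answer.

    Reading the input is linear as well, since a forest on [n] vertices has at
    most [n] edges ([size_edge_list]). *)

Set Implicit Arguments.
Unset Strict Implicit.
Unset Printing Implicit Defensive.

(** * Star colourings and their tables *)

Section Colourings.

Variables (V : finType) (G : sgraph V).
Implicit Types (f : V -> option bool) (D : {set V}).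

(** [Some true] marks the centres of the stars, [Some false] their leaves, and
    [None] the vertices outside the star forest. A leaf may be adjacent to no
    centre at all: such a leaf contributes no edge, so allowing it does not
    change the maximal weight, and it makes the condition on [D] hereditary. *)
Definition star_colouring D f : Prop :=
  (forall x y, x \in D -> y \in D -> G x y -> f x = f y -> f x = None) /\
  (forall x y z, x \in D -> y \in D -> z \in D -> G x y -> G x z ->
     f x = Some false -> f y = Some true -> f z = Some true -> y = z).

Definition spoke f x y : bool :=
  [&& G x y, f x == Some true & f y == Some false].

Definition weight D f : nat := \sum_(x in D) \sum_(y in D) spoke f x y.

Lemma eq_star_colouring D f g :
  {in D, f =1 g} -> star_colouring D f -> star_colouring D g.
Proof.
move=> fg [H1 H2]; split=> [x y xD yD | x y z xD yD zD]; rewrite -!fg //.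
  exact: H1.
exact: H2.
Qed.

Lemma eq_weight D f g : {in D, f =1 g} -> weight D f = weight D g.
Proof.
move=> fg; apply: eq_bigr => x xD; apply: eq_bigr => y yD.
by rewrite /spoke !fg.
Qed.

(** What the rest of the graph needs to know about the root [r] of a block [D].
    [Free] is a leaf that can still receive a centre outside [D]; [Leaf] is
    an arbitrary leaf, so that every [Free] colouring is also a [Leaf] one. *)
Inductive role := Outside | Centre | Free | Leaf.

Definition has_role D r f (s : role) : Prop :=
  match s with
  | Outside => f r = None
  | Centre => f r = Some true
  | Free => f r = Some false /\ (forall y, y \in D -> G r y -> f y <> Some true)
  | Leaf => f r = Some false
  end.

Lemma eq_has_role D r f g s : r \in D ->
  {in D, f =1 g} -> has_role D r f s -> has_role D r g s.
Proof.
move=> rD fg; case: s => /=; rewrite -fg //.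
by case=> fr H; split=> // y yD; rewrite -fg //; apply: H.
Qed.

Definition optimum D r s k : Prop :=
  (forall f, star_colouring D f -> has_role D r f s -> weight D f <= k) /\
  (exists f, [/\ star_colouring D f, has_role D r f s & weight D f = k]).

Definition optima D r (t : role -> nat) : Prop := forall s, optimum D r s (t s).

Lemma optima_set1 r : optima [set r] r (fun=> 0).
Proof.
have w0 f : weight [set r] f = 0.
  by rewrite /weight !big_set1 /spoke adj_irrefl.
have sc f : star_colouring [set r] f.
  split=> [x y /set1P-> /set1P-> | x y z /set1P-> /set1P-> /set1P->] //.
  by rewrite adj_irrefl.
move=> s; split=> [f _ _|]; first by rewrite w0.
exists (fun=> match s with
  | Outside => None | Centre => Some true | _ => Some false end).
by split=> //; case: s.
Qed.

(** Tables of two blocks joined by an edge between their roots, the root of the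
    first one becoming the root of the union. The successors count the joining
    edge when it becomes an edge of a star. *)
Definition attach (t1 t2 : role -> nat) (s : role) : nat :=
  match s with
  | Outside =>
      t1 Outside + maxn (maxn (t2 Outside) (t2 Centre)) (t2 Leaf)
  | Centre => t1 Centre + maxn (t2 Outside) (t2 Free).+1
  | Free => t1 Free + t2 Outside
  | Leaf => maxn (t1 Leaf + t2 Outside) (t1 Free + t2 Centre).+1
  end.

(** [compatible s s1 s2 b]: roles [s1] and [s2] of the two roots may be combined
    into role [s] for the first root, with [b] star edges gained on the bridge.
    Both inequalities between [attach] and the true optima run over this
    list of cases. *)
Inductive compatible : role -> role -> role -> nat -> Prop :=
| OutsideOutside : compatible Outside Outside Outside 0
| OutsideCentre : compatible Outside Outside Centre 0
| OutsideLeaf : compatible Outside Outside Leaf 0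
| CentreOutside : compatible Centre Centre Outside 0
| CentreFree : compatible Centre Centre Free 1
| FreeOutside : compatible Free Free Outside 0
| LeafOutside : compatible Leaf Leaf Outside 0
| LeafCentre : compatible Leaf Free Centre 1.

Lemma le_attach t1 t2 s s1 s2 b :
  compatible s s1 s2 b -> t1 s1 + t2 s2 + b <= attach t1 t2 s.
Proof. by case=> /=; lia. Qed.

Lemma attach_attained t1 t2 s : exists s1 s2 b,
  compatible s s1 s2 b /\ attach t1 t2 s = t1 s1 + t2 s2 + b.
Proof.
case: s.
- have [->|[->|->]] : attach t1 t2 Outside = t1 Outside + t2 Outside + 0 \/
    attach t1 t2 Outside = t1 Outside + t2 Centre + 0 \/
    attach t1 t2 Outside = t1 Outside + t2 Leaf + 0 by rewrite /=; lia.
  + by do 3!eexists; split; first exact: OutsideOutside.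
  + by do 3!eexists; split; first exact: OutsideCentre.
  + by do 3!eexists; split; first exact: OutsideLeaf.
- have [->|->] : attach t1 t2 Centre = t1 Centre + t2 Outside + 0 \/
    attach t1 t2 Centre = t1 Centre + t2 Free + 1 by rewrite /=; lia.
  + by do 3!eexists; split; first exact: CentreOutside.
  + by do 3!eexists; split; first exact: CentreFree.
- by exists Free, Outside, 0; split; [exact: FreeOutside | rewrite addn0].
- have [->|->] : attach t1 t2 Leaf = t1 Leaf + t2 Outside + 0 \/
    attach t1 t2 Leaf = t1 Free + t2 Centre + 1 by rewrite /=; lia.
  + by do 3!eexists; split; first exact: LeafOutside.
  + by do 3!eexists; split; first exact: LeafCentre.
Qed.

Section Bridge.

Variables (D1 D2 : {set V}) (r1 r2 : V).
Hypotheses (r1D : r1 \in D1) (r2D : r2 \in D2) (dis : [disjoint D1 & D2]).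
Hypothesis r12 : G r1 r2.
Hypothesis bridge : forall x y, x \in D1 -> y \in D2 -> G x y -> x = r1 /\ y = r2.

(** The only pair of adjacent vertices that the two blocks do not already count
    is the pair of roots. *)
Lemma weight_bridge f : weight (D1 :|: D2) f =
  weight D1 f + weight D2 f + (spoke f r1 r2 + spoke f r2 r1).
Proof.
have cross (g : V -> V -> nat) : (forall x y, ~~ G x y -> g x y = 0) ->
    \sum_(x in D1) \sum_(y in D2) g x y = g r1 r2.
  move=> g0; rewrite (bigD1 r1) //= [X in _ + X]big1 => [|x /andP[xD xr]].
    rewrite addn0 (bigD1 r2) //= big1 ?addn0 // => y /andP[yD yr].
    apply: g0; apply/negP => /(bridge r1D yD)[_ yE].
    by rewrite yE eqxx in yr.
  apply: big1 => y yD; apply: g0; apply/negP => /(bridge xD yD)[xE _].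
  by rewrite xE eqxx in xr.
have sp0 x y : ~~ G x y -> spoke f x y = 0 :> nat by rewrite /spoke => /negbTE->.
have dis' (A B : {set V}) : [disjoint A & B] ->
    forall F : V -> nat,
    \sum_(i in A :|: B) F i = \sum_(i in A) F i + \sum_(i in B) F i.
  by move=> AB F; rewrite -bigU //; apply: eq_bigl => i; rewrite inE.
rewrite /weight dis' //.
under eq_bigr do rewrite dis' //.
under [X in _ + X]eq_bigr do rewrite dis' //.
rewrite !big_split /= (cross (fun x y => nat_of_bool (spoke f x y))) //.
rewrite [X in _ + (X + _)]exchange_big /= (cross (fun x y => nat_of_bool (spoke f y x))).
  lia.
by move=> x y; rewrite adj_sym; apply: sp0.
Qed.

(** If the bridge carries a star edge, its leaf end already has its one centre
    across the bridge, hence none in its own block: it is [Free] there. *)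
Lemma split_choice f s : star_colouring (D1 :|: D2) f ->
  has_role (D1 :|: D2) r1 f s ->
  exists s1 s2 b, [/\ compatible s s1 s2 b,
    star_colouring D1 f /\ has_role D1 r1 f s1,
    star_colouring D2 f /\ has_role D2 r2 f s2 &
    weight (D1 :|: D2) f = weight D1 f + weight D2 f + b].
Proof.
move=> [H1 H2] hs.
have U1 x : x \in D1 -> x \in D1 :|: D2 by rewrite inE => ->.
have U2 x : x \in D2 -> x \in D1 :|: D2 by rewrite inE => ->; rewrite orbT.
have S1 : star_colouring D1 f.
  by split=> [x y /U1 xD /U1 yD|x y z /U1 xD /U1 yD /U1 zD]; [apply: H1|apply: H2].
have S2 : star_colouring D2 f.
  by split=> [x y /U2 xD /U2 yD|x y z /U2 xD /U2 yD /U2 zD]; [apply: H1|apply: H2].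
have h12 := H1 _ _ (U1 _ r1D) (U2 _ r2D) r12.
have r21 : G r2 r1 by rewrite adj_sym.
have neq y : y \in D1 -> y <> r2.
  by move=> yD yE; have := disjointFr dis yD; rewrite yE r2D.
have neq' y : y \in D2 -> y <> r1.
  by move=> yD yE; have := disjointFl dis yD; rewrite yE r1D.
rewrite weight_bridge /spoke r12 r21 /=.
case: s hs => /= [f1|f1|[f1 nc]|f1]; rewrite f1 /= ?andbF.
- case f2: (f r2) => [[]|].
  + by exists Outside, Centre, 0; split=> //; constructor.
  + by exists Outside, Leaf, 0; split=> //; constructor.
  + by exists Outside, Outside, 0; split=> //; constructor.
- case f2: (f r2) h12 => [[]|] h12.
  + by rewrite f1 in h12; have := h12 erefl.
  + exists Centre, Free, 1; split=> //; first constructor.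
    split=> //; split=> // y yD ry fy.
    apply: (neq' _ yD); apply/esym.
    exact: (H2 _ _ _ (U2 _ r2D) (U1 _ r1D) (U2 _ yD) r21 ry).
  + by exists Centre, Outside, 0; split=> //; constructor.
- case f2: (f r2) h12 (nc _ (U2 _ r2D) r12) => [[]|] h12 nc2 //.
  + by rewrite f1 in h12; have := h12 erefl.
  + exists Free, Outside, 0; split=> //; first constructor.
    by split=> //; split=> // y /U1; apply: nc.
- case f2: (f r2) h12 => [[]|] h12.
  + exists Free, Centre, 1; split=> //; first constructor.
    split=> //; split=> // y yD ry fy; apply: (neq _ yD).
    exact: (H2 _ _ _ (U1 _ r1D) (U1 _ yD) (U2 _ r2D) ry r12).
  + by rewrite f1 in h12; have := h12 erefl.
  + by exists Leaf, Outside, 0; split=> //; constructor.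
Qed.

(** Conversely, the conditions that the union adds to those of the blocks only
    concern the two roots, and a [Free] leaf leaves room for one centre. *)
Lemma glue_choice f s s1 s2 b : compatible s s1 s2 b ->
  star_colouring D1 f -> has_role D1 r1 f s1 ->
  star_colouring D2 f -> has_role D2 r2 f s2 ->
  [/\ star_colouring (D1 :|: D2) f, has_role (D1 :|: D2) r1 f s &
    weight (D1 :|: D2) f = weight D1 f + weight D2 f + b].
Proof.
move=> ch [A1 A2] hr1 [B1 B2] hr2.
have r21 : G r2 r1 by rewrite adj_sym.
have bridge' x y : x \in D2 -> y \in D1 -> G x y -> x = r2 /\ y = r1.
  by move=> xD yD; rewrite adj_sym => /(bridge yD xD)[].
(* All that the bridge can break, in terms of the two roots only. *)
have core : [/\ f r1 = f r2 -> f r1 = None,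
    f r1 = Some false -> f r2 = Some true ->
      forall y, y \in D1 -> G r1 y -> f y <> Some true,
    f r2 = Some false -> f r1 = Some true ->
      forall y, y \in D2 -> G r2 y -> f y <> Some true
    & spoke f r1 r2 + spoke f r2 r1 = b].
  rewrite /spoke r12 r21 /=.
  case: ch hr1 hr2 => /=.
  - by move=> -> ->; split.
  - by move=> -> ->; split.
  - by move=> -> ->; split.
  - by move=> -> ->; split.
  - by move=> -> [-> nc]; split=> // _ _.
  - by move=> [-> _] ->; split.
  - by move=> -> ->; split.
  - by move=> [-> nc] ->; split=> // _ _.
have [C1 C2 C3 C4] := core.
split; last 1 first.
- by rewrite weight_bridge C4.
- split=> [x y|x y z]; rewrite !inE.
    move=> /orP[xD|xD] /orP[yD|yD] xy fxy.
    + exact: (A1 x y).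
    + by have [xE yE] := bridge xD yD xy; move: fxy; rewrite xE yE; apply: C1.
    + have [xE yE] := bridge' _ _ xD yD xy; move: fxy; rewrite xE yE => e.
      by rewrite e; apply: C1.
    + exact: (B1 x y).
  move=> /orP[xD|xD] /orP[yD|yD] /orP[zD|zD] xy xz fx fy fz.
  + exact: (A2 x y z).
  + have [xE zE] := bridge xD zD xz; subst x z.
    by case: (C2 fx fz y yD xy).
  + have [xE yE] := bridge xD yD xy; subst x y.
    by case: (C2 fx fy z zD xz).
  + by have [_ ->] := bridge xD yD xy; have [_ ->] := bridge xD zD xz.
  + by have [_ ->] := bridge' _ _ xD yD xy; have [_ ->] := bridge' _ _ xD zD xz.
  + have [xE yE] := bridge' _ _ xD yD xy; subst x y.
    by case: (C3 fx fy z zD xz).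
  + have [xE zE] := bridge' _ _ xD zD xz; subst x z.
    by case: (C3 fx fz y yD xy).
  + exact: (B2 x y z).
- case: ch hr1 hr2 => //=; last by case.
  move=> [f1 nc] f2; split=> // y; rewrite inE => /orP[yD|yD] ry; first exact: nc.
  by have [_ ->] := bridge r1D yD ry; rewrite f2.
Qed.

(** The recurrence of the dynamic programme. It applies to trees because an edge
    of a tree is the only one between the two sides that it separates. *)
Lemma optima_bridge t1 t2 :
  optima D1 r1 t1 -> optima D2 r2 t2 -> optima (D1 :|: D2) r1 (attach t1 t2).
Proof.
move=> o1 o2 s; split=> [f sf rf|].
  have [s1 [s2 [b [ch [S1 R1] [S2 R2] ->]]]] := split_choice sf rf.
  apply: leq_trans (le_attach t1 t2 ch).
  by rewrite !leq_add //; [apply: (o1 s1).1 | apply: (o2 s2).1].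
have [s1 [s2 [b [ch ->]]]] := attach_attained t1 t2 s.
have [_ [f1 [S1 R1 W1]]] := o1 s1; have [_ [f2 [S2 R2 W2]]] := o2 s2.
pose f x := if x \in D1 then f1 x else f2 x.
have e1 : {in D1, f1 =1 f} by move=> x xD; rewrite /f xD.
have e2 : {in D2, f2 =1 f} by move=> x xD; rewrite /f (disjointFl dis xD).
have [S R W] := glue_choice ch (eq_star_colouring e1 S1) (eq_has_role r1D e1 R1)
  (eq_star_colouring e2 S2) (eq_has_role r2D e2 R2).
exists f; split=> //.
by rewrite W -(eq_weight e1) -(eq_weight e2) W1 W2.
Qed.

End Bridge.

End Colourings.

(** * Edge open packings as star colourings *)

Section EOP.

Variables (V : finType) (G : sgraph V).
Implicit Types (f : V -> option bool) (B : {set {set V}}).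

Lemma adj_neq x y : G x y -> x != y.
Proof. by apply: contraTneq => ->; rewrite adj_irrefl. Qed.

Lemma eq_set2 (a b x y : V) :
  [set a; b] = [set x; y] -> (a = x /\ b = y) \/ (a = y /\ b = x).
Proof.
move=> E; have := set21 a b; have := set22 a b; have := set21 x y; have := set22 x y.
rewrite -E {3 4}E !inE.
by do 4![case/orP=> /eqP ?]; subst; auto.
Qed.

Lemma edgesP e : reflect (exists x y, G x y /\ e = [set x; y]) (e \in edges G).
Proof.
apply: (iffP imsetP) => [[[x y]]|[x [y [xy ->]]]].
  by rewrite inE /= => xy ->; exists x, y.
by exists (x, y); rewrite ?inE.
Qed.

Lemma mem_edges x y : ([set x; y] \in edges G) = G x y.
Proof.
apply/edgesP/idP => [[a [b [ab /eq_set2 E]]]|xy]; last by exists x, y.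
by case: E => -[-> ->] //; rewrite adj_sym.
Qed.

Lemma eop_setP B : reflect
  (B \subset edges G /\ forall x y e1 e2, e1 \in B -> e2 \in B -> e1 != e2 ->
     x \in e1 -> y \in e2 -> G x y -> [set x; y] = e1 \/ [set x; y] = e2)
  (eop_set G B).
Proof.
apply: (iffP andP) => -[BE H]; split=> //.
  move=> x y e1 e2 e1B e2B ne xe ye xy.
  move/forall_inP: H => /(_ _ e1B)/forall_inP/(_ _ e2B)/implyP/(_ ne).
  move/existsPn/(_ [set x; y]); rewrite negb_and => /orP[|/existsPn/(_ x)].
    rewrite !inE mem_edges xy andbT negbK => /orP[] /eqP ->; auto.
  by rewrite xe /= => /existsPn/(_ y); rewrite ye eqxx.
apply/forall_inP => e1 e1B; apply/forall_inP => e2 e2B; apply/implyP => ne.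
apply/existsPn => e; rewrite negb_and -implybE; apply/implyP.
rewrite !inE => /andP[ne12 eE].
apply/existsPn => x; rewrite negb_and -implybE; apply/implyP => xe.
apply/existsPn => y; rewrite negb_and -implybE; apply/implyP => ye.
apply: contra ne12 => /eqP eq_e; rewrite eq_e mem_edges in eE.
by rewrite eq_e; case: (H _ _ _ _ e1B e2B ne xe ye eE) => ->; rewrite eqxx ?orbT.
Qed.

Definition spokes f : {set {set V}} :=
  [set [set p.1; p.2] | p : V * V & spoke G f p.1 p.2].

Lemma card_spokes f : #|spokes f| = weight G [set: V] f.
Proof.
rewrite card_in_imset.
  rewrite -sum1dep_card (eq_bigl (fun p : V * V => true && spoke G f p.1 p.2)) //.
  rewrite -(pair_big_dep xpredT (fun x y => spoke G f x y) (fun _ _ => 1)) /weight /=.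
  rewrite (eq_bigl _ _ (in_setT (T := V))); apply: eq_bigr => x _.
  rewrite (eq_bigl _ _ (in_setT (T := V))) big_mkcond; apply: eq_bigr => y _.
  by case: spoke.
move=> [x y] [a b]; rewrite !inE /= => /and3P[_ /eqP fx /eqP fy] /and3P[_ /eqP fa /eqP fb].
by case/eq_set2=> -[-> xE] //; [rewrite xE | subst; congruence].
Qed.

(** An edge between two coloured vertices joins a centre to a leaf; as that leaf
    has only one centre, the packing edge through it is this very edge. *)
Lemma eop_spokes f : star_colouring G [set: V] f -> eop_set G (spokes f).
Proof.
move=> [H1 H2]; apply/eop_setP; split.
  by apply/subsetP => e /imsetP[[x y]]; rewrite inE /= => /and3P[xy _ _] ->; rewrite mem_edges.
have leaf_edge y e x : e \in spokes f -> y \in e -> f y = Some false -> G y x ->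
    f x = Some true -> [set x; y] = e.
  move=> /imsetP[[a b]]; rewrite inE /= => /and3P[ab /eqP fa /eqP fb] ->.
  rewrite !inE => /orP[/eqP yE|/eqP->]; first by rewrite yE fa.
  move=> _ bx fx; congr [set _; _].
  by apply: (H2 b) => //; rewrite adj_sym.
have coloured y e : e \in spokes f -> y \in e -> f y <> None.
  move=> /imsetP[[a b]]; rewrite inE /= => /and3P[_ /eqP fa /eqP fb] ->.
  by rewrite !inE => /orP[] /eqP ->; rewrite ?fa ?fb.
move=> x y e1 e2 e1B e2B _ xe ye xy.
have xn := coloured _ _ e1B xe; have yn := coloured _ _ e2B ye.
have := H1 x y (in_setT _) (in_setT _) xy.
case fx: (f x) xn => [[]|] // _; case fy: (f y) yn => [[]|] // _ h; try by have := h erefl.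
- by right; apply: leaf_edge ye fy _ fx => //; rewrite adj_sym.
- by left; rewrite setUC; apply: leaf_edge xe fx _ fy.
Qed.

End EOP.

Section Stars.
Variables (n : nat) (G : sgraph 'I_n) (B : {set {set 'I_n}}).
Hypothesis eopB : eop_set G B.

Let b x y := [set x; y] \in B.

(** Every connected component of an edge open packing is a star. A vertex on
    several packing edges has to be a centre; in a component with a single edge
    either end would do, and the order on ['I_n] selects the smaller one. *)
Lemma star_of_eop : exists f, star_colouring G [set: 'I_n] f /\ B \subset spokes G f.
Proof.
have [BE H] := eop_setP _ _ eopB.
have bsym x y : b x y = b y x by rewrite /b setUC.
have bG x y : b x y -> G x y by move=> /(subsetP BE); rewrite mem_edges.
pose covered x := [exists y, b x y].
pose many x := [exists y, exists z, [&& y != z, b x y & b x z]].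
have cov x y : covered x -> covered y -> G x y -> b x y.
  move=> /existsP[u xu] /existsP[w yw] xy; apply/negPn/negP => nb.
  case: (eqVneq [set x; u] [set y; w]) => [E|ne].
    by case/eq_set2: E => -[xE uE];
      [rewrite xE adj_irrefl in xy | rewrite -uE -/(b _ _) xu in nb].
  have := H x y _ _ xu yw ne (set21 _ _) (set21 _ _) xy.
  by case=> E; move: nb; rewrite /b E => /negP[].
(* Two adjacent centres would be the middle of a path of three packing edges. *)
have many_edge x y : b x y -> many x -> many y -> False.
  move=> xy mx my.
  have other u v : many u -> exists2 w, w != v & b u w.
    move=> /existsP[w1 /existsP[w2 /and3P[ne u1 u2]]].
    by case: (eqVneq w1 v) => [E|]; [exists w2; rewrite // -E eq_sym | exists w1].
  have [u uy xu] := other _ y mx; have [w wx yw] := other _ x my.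
  have xy' := bG _ _ xy; have nxy := adj_neq xy'.
  case: (eqVneq [set x; u] [set y; w]) => [/eq_set2[[E _]|[E _]]|ne].
  - by rewrite E eqxx in nxy.
  - by rewrite E eqxx in wx.
  case: (H x y _ _ xu yw ne (set21 _ _) (set21 _ _) xy') => /eq_set2.
    by case=> [[_ E]|[E _]]; [rewrite E eqxx in uy |
      rewrite E in xu; move: (adj_neq (bG _ _ xu)); rewrite eqxx].
  by case=> [[E _]|[E _]]; [rewrite E eqxx in nxy | rewrite E eqxx in wx].
have uniq_nbr x y z : ~~ many x -> b x y -> b x z -> y = z.
  move=> nm xy xz; apply/eqP/negPn/negP => ne; case/negP: nm.
  by apply/existsP; exists y; apply/existsP; exists z; rewrite ne xy.
pose centre x := many x || [exists y, [&& b x y, ~~ many y & x < y]].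
pose f x := if covered x then Some (centre x) else None.
have fS x c : f x = Some c -> covered x /\ centre x = c.
  by rewrite /f; case: (covered x) => // -[->].
have b_cov x y : b x y -> covered x by move=> xy; apply/existsP; exists y.
have opp x y : b x y -> centre x = ~~ centre y.
  wlog lt_xy : x y / x < y => [th xy|xy].
    have := adj_neq (bG _ _ xy); rewrite -val_eqE neq_ltn => /orP[|] lt; first exact: th.
    by rewrite (th _ _ lt) ?negbK // bsym.
  rewrite /centre; case mx: (many x) => /=.
    have my : many y = false by case my: (many y); first case: (many_edge _ _ xy mx my).
    rewrite my /=; apply/esym/existsPn => z; apply/negP => /and3P[yz nz _].
    have zx : z = x by apply: uniq_nbr yz _; rewrite ?my // bsym.
    by rewrite zx mx in nz.
  case my: (many y) => /=.
    apply/existsPn => z; apply/negP => /and3P[xz nz _].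
    have zy : z = y by apply: uniq_nbr xz xy; rewrite mx.
    by rewrite zy my in nz.
  have -> : [exists z, [&& b x z, ~~ many z & x < z]].
    by apply/existsP; exists y; rewrite xy my.
  apply/esym/existsPn => z; apply/negP => /and3P[yz _ lt].
  have zx : z = x by apply: uniq_nbr yz _; rewrite ?my // bsym.
  by rewrite zx in lt; lia.
exists f; split; [split|].
- move=> x y _ _ xy fxy; case fx: (f x) => [c|//].
  have [cx ex] := fS _ _ fx; have [cy ey] := fS _ _ (etrans (esym fxy) fx).
  by have := opp _ _ (cov _ _ cx cy xy); rewrite ex ey; case: (c).
- move=> x y z _ _ _ xy xz /fS[cx ex] /fS[cy _] /fS[cz _].
  move/negbT: ex; rewrite negb_or => /andP[nm _].
  by apply: uniq_nbr nm _ _; apply: cov.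
- apply/subsetP => e eB; have := subsetP BE _ eB => /edgesP[x [y [xy eE]]].
  have bxy : b x y by rewrite /b -eE.
  have [cx cy] : covered x /\ covered y by split; [|rewrite bsym in bxy]; apply: b_cov bxy.
  have := opp _ _ bxy; case ex: (centre x); case ey: (centre y) => // _.
    by apply/imsetP; exists (x, y); rewrite // inE /spoke xy /f cx cy ex ey.
  apply/imsetP; exists (y, x); last by rewrite eE setUC.
  by rewrite inE /spoke adj_sym xy /f cx cy ex ey.
Qed.

End Stars.

Lemma eop_number_root n (G : sgraph 'I_n) r t : optima G [set: 'I_n] r t ->
  eop_number G = maxn (maxn (t Outside) (t Centre)) (t Leaf).
Proof.
move=> opt; apply/eqP; rewrite eqn_leq; apply/andP; split.
  apply/bigmax_leqP => B /star_of_eop[f [sf /subset_leq_card]].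
  rewrite card_spokes => leB; apply: leq_trans leB _.
  case fr: (f r) => [[]|].
  - have := (opt Centre).1 f sf fr; lia.
  - have := (opt Leaf).1 f sf fr; lia.
  - have := (opt Outside).1 f sf fr; lia.
have lb s : t s <= eop_number G.
  have [_ [f [sf _ <-]]] := opt s; rewrite -card_spokes.
  exact: leq_bigmax_cond (eop_spokes sf).
by rewrite !geq_max !lb.
Qed.

(** * Leaves of forests and the contraction of blocks *)

Section Forest.

Variables (V : finType) (G : sgraph V).
Implicit Types (R : {set V}) (g : V -> nat).

(** With [g] constant this is the degree inside [R]; with [g] the address of a
    vertex it is the quantity that lets a leaf find its neighbour. *)
Definition nbr_sum g R x : nat := \sum_(y in R) G x y * g y.
Definition degree R x := nbr_sum (fun=> 1) R x.

Lemma nbr_sumD1 g R v x : v \in R ->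
  nbr_sum g R x = G x v * g v + nbr_sum g (R :\ v) x.
Proof. exact: big_setD1. Qed.

Lemma leaf_nbr R v : degree R v = 1 ->
  exists p, [/\ p \in R, G v p, forall y, y \in R -> G v y -> y = p &
    forall g, nbr_sum g R v = g p].
Proof.
move=> d1; have /existsP[p /andP[pR vp]] : [exists p, (p \in R) && G v p].
  apply: contraT => /existsPn no; move: d1; rewrite /degree /nbr_sum big1 // => y yR.
  by have := no y; rewrite yR /= => /negbTE ->.
have u y : y \in R -> G v y -> y = p.
  move=> yR vy; apply/eqP/negPn/negP => ne; move: d1.
  by rewrite /degree (nbr_sumD1 _ _ pR) (@nbr_sumD1 _ _ y) ?inE ?ne // vp vy; lia.
exists p; split=> // g; rewrite (nbr_sumD1 _ _ pR) vp mul1n /nbr_sum big1 ?addn0 // => y.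
rewrite !inE => /andP[ne yR]; case vy: (G v y) => //.
by rewrite (u _ yR vy) eqxx in ne.
Qed.

(** Otherwise a path could be prolonged for ever: its first vertex [a] has a
    neighbour [c] other than the second one, and [c] is new since a neighbour
    further along the path would close a cycle. *)
Lemma exists_leaf R x y : acyclic G -> x \in R -> y \in R -> G x y ->
  exists2 v, v \in R & degree R v = 1.
Proof.
move=> acy xR yR xy; case: (pickP [pred v in R | degree R v == 1]) => [v /andP[vR /eqP]|none].
  by exists v.
suff long k : exists a s, [/\ path G a s, uniq (a :: s), all (mem R) (a :: s) & size s = k.+1].
  have [a [s [_ us _ ss]]] := long #|V|.
  have : size (a :: s) <= #|V| by rewrite -(card_uniqP us) max_card.
  by rewrite /= ss ltnNge leqW.
elim: k => [|k [a [s [ps us als ss]]]].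
  exists x, [:: y]; rewrite /= xy xR yR inE andbT; split=> //.
  by rewrite (adj_neq xy).
case: s ps us als ss => // b s /= /andP[ab pb] /andP[as_ us] /and3P[aR bR alR] ss.
have /existsP[c /and3P[cR cb ac]] : [exists c, [&& c \in R, c != b & G a c]].
  apply: contraT => /existsPn no.
  have := none a; rewrite /= aR /= /degree (nbr_sumD1 _ _ bR) ab /nbr_sum big1 // => c.
  by rewrite !inE => /andP[cb cR]; have := no c; rewrite cR cb /= => /negbTE ->.
case cs: (c \in a :: b :: s); last first.
  by exists c, (a :: b :: s); rewrite cs /= adj_sym ac ab pb as_ us cR aR bR alR /= ss.
move: cs; rewrite inE eq_sym (negbTE (adj_neq ac)) inE (negbTE cb) /= => cs.
case/splitPr: cs pb as_ us {alR ss} => s1 s2; rewrite cat_path /= => /and3P[p1 sc _] as_ us.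
suff /acy : ucycle G (a :: b :: rcons s1 c) by rewrite /= size_rcons.
rewrite /ucycle /= !rcons_path last_rcons ab p1 sc adj_sym ac /=.
rewrite -cat_rcons -cat_cons mem_cat negb_or in as_.
rewrite -cat_rcons mem_cat negb_or cat_uniq in us.
by case/andP: as_ => -> _; case/andP: us => /andP[-> _] /andP[-> _].
Qed.

(** Deleting a leaf deletes one edge and one vertex. *)
Lemma forest_degree_sum R : acyclic G -> \sum_(x in R) degree R x <= 2 * #|R|.
Proof.
move=> acy; have [k] := ubnP #|R|; elim: k R => // k IH R ltk.
case: (pickP [pred p | [&& p.1 \in R, p.2 \in R & G p.1 p.2]]) =>
    [[x y] /= /and3P[xR yR xy]|none].
  have [v vR dv] := exists_leaf acy xR yR xy.
  have lt : #|R :\ v| < k by rewrite (cardsD1 v) vR in ltk; lia.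
  have := IH _ lt; rewrite [in X in _ -> X](cardsD1 v) vR (big_setD1 v vR) /= dv.
  have -> : \sum_(x in R :\ v) degree R x =
      \sum_(x in R :\ v) (degree (R :\ v) x + G v x * 1).
    apply: eq_bigr => z _; rewrite /degree (nbr_sumD1 _ _ vR) [G z v]adj_sym; lia.
  rewrite big_split /= -[\sum_(i in R :\ v) G v i * 1]/(degree (R :\ v) v).
  by move: dv; rewrite /degree (nbr_sumD1 _ _ vR); lia.
rewrite big1 // => x xR; rewrite /degree /nbr_sum big1 // => y yR.
by have := none (x, y); rewrite /= xR yR /= => ->.
Qed.

Definition block (own : V -> V) p := [set x | own x == p].

(** The state of the pruning: [R] is the set of remaining vertices and [own]
    sends each vertex to the remaining vertex that has absorbed it. An edge
    between different blocks joins their roots. *)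
Definition contraction R (own : V -> V) : Prop :=
  [/\ forall x, own x \in R, forall x, x \in R -> own x = x &
      forall x y, G x y -> own x <> own y -> x \in R /\ y \in R].

Definition redirect (own : V -> V) v p x := if own x == v then p else own x.

Lemma contraction_id : contraction [set: V] id.
Proof. by split. Qed.

Section Absorb.
Variables (R : {set V}) (own : V -> V) (v p : V).
Hypotheses (con : contraction R own) (vR : v \in R) (pR : p \in R) (vp : G v p).
Hypothesis pu : forall y, y \in R -> G v y -> y = p.

Lemma contraction_redirect : contraction (R :\ v) (redirect own v p).
Proof.
have [c1 c2 c3] := con; have pv : p != v by rewrite eq_sym (adj_neq vp).
split=> [x|x|x y xy]; rewrite /redirect.
- by rewrite in_setD1; case: (eqVneq (own x) v) => [_|ne]; rewrite ?pv ?ne ?pR ?c1.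
- by rewrite in_setD1 => /andP[xv xR]; rewrite c2 // (negbTE xv).
case: eqVneq => [ox|ox]; case: eqVneq => [oy|oy] // ne.
- have [xR yR] := c3 _ _ xy (ltac:(move=> E; by rewrite -E ox eqxx in oy)).
  by case: ne; rewrite c2 // (pu yR) // -ox c2.
- have [xR yR] := c3 _ _ xy (ltac:(move=> E; by rewrite E oy eqxx in ox)).
  by case: ne; rewrite c2 // (pu xR) // -oy c2 // adj_sym.
- have [xR yR] := c3 _ _ xy ne.
  by rewrite !inE xR yR; rewrite c2 // in ox; rewrite c2 // in oy; rewrite ox oy.
Qed.

Lemma optima_redirect (tab : V -> role -> nat) :
  (forall w, w \in R -> optima G (block own w) w (tab w)) ->
  forall w, w \in R :\ v -> optima G (block (redirect own v p) w) w
    (if w == p then attach (tab p) (tab v) else tab w).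
Proof.
have [c1 c2 c3] := con; have pv : p != v by rewrite eq_sym (adj_neq vp).
move=> opt w; rewrite !inE => /andP[wv wR]; case: eqVneq => [->|wp].
  have -> : block (redirect own v p) p = block own p :|: block own v.
    apply/setP => x; rewrite !inE /redirect; case: (eqVneq (own x) v) => [->|_].
      by rewrite !eqxx orbT.
    by rewrite orbF.
  apply: optima_bridge; rewrite ?inE ?c2 //; try exact: opt; last first.
  - move=> x y; rewrite !inE => /eqP ox /eqP oy xy.
    have [xR yR] : x \in R /\ y \in R by apply: c3 xy _; rewrite ox oy; apply/eqP.
    by rewrite -{1}ox -oy !c2.
  - by rewrite adj_sym.
  - rewrite -setI_eq0; apply/eqP/setP => x; rewrite !inE.
    by case: eqVneq => //= ->; apply: negbTE.
have -> : block (redirect own v p) w = block own w; last exact: opt.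
apply/setP => x; rewrite !inE /redirect; case: (eqVneq (own x) v) => // ->.
by rewrite eq_sym (negbTE wp) eq_sym (negbTE wv).
Qed.

End Absorb.

(** Without leaves there are no edges left in [R], and then a block is closed
    under adjacency, so by connectedness it is everything. *)
Lemma contraction_done R own q : acyclic G -> (forall x y, connect G x y) ->
  contraction R own -> q \in R -> (forall w, w \in R -> degree R w != 1) ->
  block own q = [set: V].
Proof.
move=> acy con [c1 c2 c3] qR nl; apply/setP => x; rewrite !inE.
have cl : closed G (block own q).
  apply: intro_closed => [y z|y z yz]; first by apply: sym_connect_sym; apply: adj_sym.
  rewrite !inE => /eqP <-; apply/eqP; apply: contraTeq isT => /eqP ne.
  have [yR zR] := c3 _ _ yz (not_eq_sym ne).
  by have [v vR dv] := exists_leaf acy yR zR yz; have := nl v vR; rewrite dv eqxx.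
have := closed_connect cl (con q x).
by rewrite !inE c2 // eqxx => <-.
Qed.

(** What adding up the contributions of the edges of the input, in any order,
    computes at [x]. *)
Lemma edge_list_sum (l : seq (V * V)) g x : edge_list G l ->
  \sum_(e <- l) ((e.1 == x) * g e.2 + (e.2 == x) * g e.1) = nbr_sum g [set: V] x.
Proof.
move=> el.
(* The contribution of an edge depends on it only as an unordered pair. *)
pose h (e : {set V}) := if x \in e then \sum_(y in e :\ x) g y else 0.
have h_set2 u w : u != w -> h [set u; w] =
    if x == u then g w else if x == w then g u else 0.
  move=> uw; rewrite /h !inE; case: eqVneq => [->|xu] /=.
    by rewrite setU1K ?inE // big_set1.
  by case: eqVneq => [->|//]; rewrite setUC setU1K ?inE 1?eq_sym // big_set1.
have mem_l e : e \in l -> G e.1 e.2.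
  move=> el'; rewrite -mem_edges -mem_enum -(perm_mem el).
  exact: (map_f (fun uv : V * V => [set uv.1; uv.2])).
have -> : \sum_(e <- l) ((e.1 == x) * g e.2 + (e.2 == x) * g e.1) =
    \sum_(e <- [seq [set uv.1; uv.2] | uv <- l]) h e.
  rewrite big_map big_seq [RHS]big_seq; apply: eq_bigr => -[u w] /mem_l /= /adj_neq uw.
  rewrite h_set2 // [x == u]eq_sym [x == w]eq_sym.
  by case: eqVneq => [<-|_]; [rewrite eq_sym (negbTE uw) mul1n addn0|case: eqP; rewrite ?mul1n].
rewrite (perm_big _ el) big_enum /= (bigID (fun e : {set V} => x \in e)) /=.
rewrite [X in _ + X]big1 => [|e /andP[_ /negbTE xe]]; last by rewrite /h xe.
rewrite addn0 /nbr_sum.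
rewrite (eq_bigl (fun e => e \in [set [set x; y] | y in G x])) => [|e]; last first.
  apply/andP/imsetP => [[/edgesP[a [b [ab ->]]]]|[y xy ->]]; last first.
    by rewrite mem_edges set21.
  rewrite !inE => /orP[] /eqP ->; first by exists b.
  exists a; last by rewrite setUC.
  by rewrite -topredE /= adj_sym.
rewrite big_imset /= => [|y z _ _ /eq_set2]; last by case=> -[] // -> ->.
rewrite big_mkcond [RHS]big_mkcond; apply: eq_bigr => y _; rewrite in_setT -topredE /=.
by case: ifP => xy; rewrite // h_set2 ?(adj_neq xy) // eqxx mul1n.
Qed.

End Forest.

(** * The program and the effect of its blocks *)

Section Running.
Variable P : program.

(** [outputs_within] from an arbitrary configuration, so that the blocks of the
    program can be chained. *)
Definition outcome t k c := halted P (iter t (step P) c) /\ reg (iter t (step P) c) 0 = k.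

Lemma outcome_iter s t k c : outcome t k (iter s (step P) c) -> outcome (s + t) k c.
Proof. by rewrite /outcome addnC iterD. Qed.

Lemma outcome_leq t t' k c : t <= t' -> outcome t k c -> outcome t' k c.
Proof.
move=> /subnK <-; elim: (t' - t) => // d IH /IH; rewrite addSn /outcome iterS.
set c' := iter _ _ _ => -[h]; suff -> : step P c' = c' by split.
by move: h; rewrite /halted /step; case: fetch.
Qed.

End Running.

(** Registers 1 to 6 hold their own number throughout, as arithmetic only takes
    registers as operands. Registers from 15 on are scratch. *)
Definition rout := 0.
Definition rzero := 7.
Definition rn := 8.
Definition rbase := 9.
Definition rend := 10.
Definition rnext := 11.
Definition rroot := 12.
Definition rcur := 13.
Definition rpar := 14.

(** The lines at which the successive blocks of [eop_program] begin. *)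
Definition edge_label := 14.
Definition store_label := 22.
Definition prune_label := 45.
Definition next_label := 47.
Definition test_label := 50.
Definition absorb_label := 53.
Definition finish_label := 101.

Definition goto q := IJumpLe rzero rzero q.

(** Vertex [x] owns the six cells from [2n + 3 + 6x] on: its degree, the sum of
    the addresses of its neighbours, and its table for the roles [Outside],
    [Centre], [Free] and [Leaf]. A forest has at most [n] edges, so the input and
    two zero cells after it fit below [2n + 3]. *)
Definition setup : program :=
  [:: IConst 1 1; IConst 2 2; IConst 3 3; IConst 4 4; IConst 5 5; IConst 6 6;
      IRead rn rzero;
      IAdd rbase rn rn; IAdd rbase rbase 3;
      IAdd rend rn rn; IAdd rend rend rn; IAdd rend rend rend; IAdd rend rend rbase;
      IAdd rnext 1 rzero].

(** The length of the edge list is not given, but an edge has two different ends: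
    the first pair of equal cells is the zero memory after the input. *)
Definition read_edge : program :=
  [:: IRead rcur rnext; IAdd rnext rnext 1;
      IRead rpar rnext; IAdd rnext rnext 1;
      ISub 15 rcur rpar; ISub 16 rpar rcur; IAdd 15 15 16;
      IJumpLe 15 rzero prune_label].

Definition store_edge : program :=
  [:: IAdd 15 rcur rcur; IAdd 15 15 rcur; IAdd 15 15 15; IAdd rcur rbase 15;
      IAdd 15 rpar rpar; IAdd 15 15 rpar; IAdd 15 15 15; IAdd rpar rbase 15;
      IRead 15 rcur; IAdd 15 15 1;
      IRead 16 rpar; IAdd 16 16 1;
      IAdd 17 rcur 1; IRead 19 17; IAdd 19 19 rpar;
      IAdd 18 rpar 1; IRead 20 18; IAdd 20 20 rcur;
      IWrite rcur 15; IWrite rpar 16; IWrite 17 19; IWrite 18 20;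
      goto edge_label].

Definition prune : program := [:: IAdd rnext rbase rzero; IAdd rroot rbase rzero].

Definition next_vertex : program :=
  [:: IJumpLe rend rnext finish_label;
      IAdd rcur rnext rzero; IAdd rnext rnext 6].

Definition test_leaf : program :=
  [:: IRead 15 rcur; IJumpLe 15 rzero next_label; IJumpLe 2 15 next_label].

(** The current vertex has degree one, so its second cell is the address of its
    neighbour. The table of the neighbour is replaced by [attach] of the two
    tables; maxima are computed without a jump, as [a + (b - a)]. The neighbour
    then becomes the current vertex, as it may have become a leaf. *)
Definition absorb : program :=
  [:: IAdd 15 rcur 1; IRead rpar 15;
      IAdd 15 rcur 2; IRead 15 15; IAdd 16 rcur 3; IRead 16 16;
      IAdd 17 rcur 4; IRead 17 17; IAdd 18 rcur 5; IRead 18 18;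
      IAdd 20 rpar 1; IAdd 21 rpar 2; IAdd 22 rpar 3; IAdd 23 rpar 4; IAdd 24 rpar 5;
      IRead 25 rpar; IRead 26 20; IRead 27 21; IRead 28 22; IRead 29 23; IRead 30 24;
      ISub 25 25 1; ISub 26 26 rcur;
      IAdd 31 29 16; IAdd 31 31 1; IAdd 30 30 15; ISub 31 31 30; IAdd 30 30 31;
      IAdd 29 29 15;
      IAdd 17 17 1; ISub 17 17 15; IAdd 17 15 17; IAdd 28 28 17;
      ISub 16 16 15; IAdd 16 15 16; ISub 18 18 16; IAdd 16 16 18; IAdd 27 27 16;
      IWrite rcur rzero;
      IWrite rpar 25; IWrite 20 26; IWrite 21 27; IWrite 22 28; IWrite 23 29; IWrite 24 30;
      IAdd rcur rpar rzero; IAdd rroot rpar rzero;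
      goto test_label].

Definition finish : program :=
  [:: IAdd 15 rroot 2; IRead 15 15; IAdd 16 rroot 3; IRead 16 16;
      IAdd 17 rroot 5; IRead 17 17;
      ISub 16 16 15; IAdd 16 15 16; ISub 17 17 16; IAdd rout 16 17; IHalt].

Definition eop_program : program :=
  setup ++ read_edge ++ store_edge ++ prune ++ next_vertex ++ test_leaf ++
  absorb ++ finish.

Notation run k := (iter k (step eop_program)).

Definition constants (r : nat -> nat) : Prop :=
  [/\ r 1 = 1, r 2 = 2, r 3 = 3, r 4 = 4 & [/\ r 5 = 5, r 6 = 6 & r rzero = 0]].

Definition stored (m : nat -> nat) a d s (t : role -> nat) : Prop :=
  [/\ m a = d, m (a + 1) = s, m (a + 2) = t Outside, m (a + 3) = t Centre &
      m (a + 4) = t Free /\ m (a + 5) = t Leaf].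

Definition upd (m : nat -> nat) a x : nat -> nat := fun b => if b == a then x else m b.

Lemma updE m a x b : upd m a x b = if b == a then x else m b.
Proof. by []. Qed.

Definition agree k (r r' : nat -> nat) := forall i, i < k -> r' i = r i.

Lemma run_absorb r m p dv tv dp sp tp :
  constants r -> stored m (r rcur) dv p tv -> stored m p dp sp tp ->
  r rcur < p \/ p + 5 < r rcur ->
  exists r' m', [/\ run 48 (Config absorb_label r m) = Config test_label r' m',
    agree rroot r r', r' rcur = p /\ r' rroot = p,
    m' (r rcur) = 0 /\ stored m' p (dp - 1) (sp - r rcur) (attach tp tv) &
    forall a, a != r rcur -> a < p \/ p + 5 < a -> m' a = m a].
Proof.
rewrite /rcur => -[c1 c2 c3 c4 [c5 c6 c0]] [v0 v1 v2 v3 [v4 v5]] [p0 p1 p2 p3 [p4 p5]] dis.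
set c := Config absorb_label r m.
have E : agree 12 r (reg (run 48 c)) by do 12?[case=> [|] //].
have Em : memory (run 48 c) =
  let q := m (r 13 + r 1) in
  let vO := m (r 13 + r 2) in let vC := m (r 13 + r 3) in
  let vF := m (r 13 + r 4) in let vL := m (r 13 + r 5) in
  let vOC := vO + (vC - vO) in
  let pL := m (q + r 5) + vO in
  upd (upd (upd (upd (upd (upd (upd m (r 13) (r 7)) q (m q - r 1))
    (q + r 1) (m (q + r 1) - r 13))
    (q + r 2) (m (q + r 2) + (vOC + (vL - vOC))))
    (q + r 3) (m (q + r 3) + (vO + (vF + r 1 - vO))))
    (q + r 4) (m (q + r 4) + vO))
    (q + r 5) (pL + (m (q + r 4) + vC + r 1 - pL)).
  reflexivity.
have E13 : reg (run 48 c) 13 = m (r 13 + r 1) + r 7 by reflexivity.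
have E12 : reg (run 48 c) 12 = m (r 13 + r 1) + r 7 by reflexivity.
have Epc : pc (run 48 c) = if r 7 <= r 7 then test_label else 101 by reflexivity.
rewrite leqnn in Epc.
case: (run 48 c) E Em E13 E12 Epc => l r' m' /= E; rewrite c1 c2 c3 c4 c5 [r 7]c0 v1 v2 v3 v4 v5.
rewrite p0 p1 p2 p3 p4 p5 addn0 => Em E13 E12 ->.
exists r', m'; rewrite Em; split=> //.
- have F i : i <= 5 -> (r 13 == p + i) = false by lia.
  have F0 : (r 13 == p) = false by lia.
  have F' i : i <= 5 -> (p + i == r 13) = false by lia.
  have F0' : (p == r 13) = false by lia.
  have G0 i : 0 < i -> (p == p + i) = false by lia.
  have G1 i : 0 < i -> (p + i == p) = false by lia.
  rewrite /stored !updE !eqn_add2l !F // F0 !F' // F0' !G0 // !G1 // !eqxx /=.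
  by rewrite !maxnE; split=> //; split=> //; lia.
- move=> a /negbTE acur ap; rewrite !updE acur.
  have G i : i <= 5 -> (a == p + i) = false by lia.
  have G0 : (a == p) = false by lia.
  by rewrite !G // G0.
Qed.

Lemma run_setup w : let n := nth 0 w 0 in
  exists r, [/\ run 14 (init w) = Config edge_label r (nth 0 w), constants r,
    r rbase = n * 2 + 3, r rend = r rbase + n * 6 & r rnext = 1].
Proof.
move=> n; have Em : memory (run 14 (init w)) = nth 0 w by reflexivity.
have Epc : pc (run 14 (init w)) = edge_label by reflexivity.
have E1 : reg (run 14 (init w)) 1 = 1 by reflexivity.
have E2 : reg (run 14 (init w)) 2 = 2 by reflexivity.
have E3 : reg (run 14 (init w)) 3 = 3 by reflexivity.
have E4 : reg (run 14 (init w)) 4 = 4 by reflexivity.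
have E5 : reg (run 14 (init w)) 5 = 5 by reflexivity.
have E6 : reg (run 14 (init w)) 6 = 6 by reflexivity.
have E7 : reg (run 14 (init w)) rzero = 0 by reflexivity.
have E9 : reg (run 14 (init w)) rbase = n + n + 3 by reflexivity.
have E10 : reg (run 14 (init w)) rend = n + n + n + (n + n + n) + (n + n + 3) by reflexivity.
have E11 : reg (run 14 (init w)) rnext = 1 + 0 by reflexivity.
case: (run 14 (init w)) Em Epc E1 E2 E3 E4 E5 E6 E7 E9 E10 E11 => l r m /= -> -> *.
by exists r; split=> //; lia.
Qed.

Lemma run_read_edge r m u w : constants r ->
  m (r rnext) = u -> m (r rnext + 1) = w ->
  exists r', [/\ run 8 (Config edge_label r m) =
      Config (if u == w then prune_label else store_label) r' m,
    agree rnext r r', r' rnext = r rnext + 2, r' rcur = u & r' rpar = w].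
Proof.
rewrite /rnext /rcur /rpar => -[c1 _ _ _ [_ _ c0]] mu mw.
set c := Config edge_label r m.
have E : agree 11 r (reg (run 8 c)) by do 11?[case=> [|] //].
have E11 : reg (run 8 c) 11 = r 11 + r 1 + r 1 by reflexivity.
have E13 : reg (run 8 c) 13 = m (r 11) by reflexivity.
have E14 : reg (run 8 c) 14 = m (r 11 + r 1) by reflexivity.
have Em : memory (run 8 c) = m by reflexivity.
have Epc : pc (run 8 c) =
  if (m (r 11) - m (r 11 + r 1)) + (m (r 11 + r 1) - m (r 11)) <= r 7
  then prune_label else store_label by reflexivity.
case: (run 8 c) E E11 E13 E14 Em Epc => l r' m' /= E.
rewrite c1 [r 7]c0 mu mw => E11 E13 E14 -> ->; exists r'; split=> //; last by rewrite E11; lia.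
by congr Config; have -> : (u - w + (w - u) <= 0) = (u == w) by lia.
Qed.

Lemma run_store_edge r m u w b : constants r -> r rbase = b ->
  r rcur = u -> r rpar = w -> u != w ->
  exists r' m', [/\ run 23 (Config store_label r m) = Config edge_label r' m',
    agree rroot r r',
    m' (b + u * 6) = m (b + u * 6) + 1 /\
    m' (b + u * 6 + 1) = m (b + u * 6 + 1) + (b + w * 6),
    m' (b + w * 6) = m (b + w * 6) + 1 /\
    m' (b + w * 6 + 1) = m (b + w * 6 + 1) + (b + u * 6) &
    forall a, (forall x, x = u \/ x = w -> a != b + x * 6 /\ a != b + x * 6 + 1) ->
      m' a = m a].
Proof.
rewrite /rbase /rcur /rpar => -[c1 _ _ _ [_ _ c0]] rb ru rw ne.
set c := Config store_label r m.
have E : agree 12 r (reg (run 23 c)) by do 12?[case=> [|] //].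
have Em : memory (run 23 c) =
  let pu := r 9 + (r 13 + r 13 + r 13 + (r 13 + r 13 + r 13)) in
  let pw := r 9 + (r 14 + r 14 + r 14 + (r 14 + r 14 + r 14)) in
  upd (upd (upd (upd m pu (m pu + r 1)) pw (m pw + r 1))
    (pu + r 1) (m (pu + r 1) + pw)) (pw + r 1) (m (pw + r 1) + pu) by reflexivity.
have Epc : pc (run 23 c) = if r 7 <= r 7 then edge_label else 45 by reflexivity.
rewrite leqnn in Epc.
case: (run 23 c) E Em Epc => l r' m' /= E; rewrite c1 rb ru rw.
have six x : x + x + x + (x + x + x) = x * 6 by lia.
rewrite !six => -> ->; eexists; eexists; split; first reflexivity; rewrite ?updE //.
- by split; repeat (case: eqP => ?; try lia).
- by split; repeat (case: eqP => ?; try lia).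
- move=> a H; have [h1 h2] := H u (or_introl erefl); have [h3 h4] := H w (or_intror erefl).
  by rewrite !updE !ifN.
Qed.

Lemma run_prune r m : constants r ->
  exists r', [/\ run 2 (Config prune_label r m) = Config next_label r' m,
    agree rnext r r', r' rnext = r rbase & r' rroot = r rbase].
Proof.
move=> [_ _ _ _ [_ _ c0]]; set c := Config prune_label r m.
have E : agree 11 r (reg (run 2 c)) by do 11?[case=> [|] //].
have E11 : reg (run 2 c) rnext = r rbase + r rzero by reflexivity.
have E12 : reg (run 2 c) rroot = r rbase + r rzero by reflexivity.
have Em : memory (run 2 c) = m by reflexivity.
have Epc : pc (run 2 c) = next_label by reflexivity.
case: (run 2 c) E E11 E12 Em Epc => l r' m' /= E; rewrite c0 addn0 => E11 E12 -> ->.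
by exists r'.
Qed.

Lemma run_next_vertex r m : constants r -> r rnext < r rend ->
  exists r', [/\ run 3 (Config next_label r m) = Config test_label r' m,
    agree rnext r r', r' rcur = r rnext, r' rnext = r rnext + 6 & r' rroot = r rroot].
Proof.
move=> [_ _ _ _ [_ c6 c0]]; rewrite ltnNge => /negbTE lt.
have E0 : run 1 (Config next_label r m) =
  Config (if r rend <= r rnext then finish_label else 48) r m by reflexivity.
rewrite -[3]/(2 + 1) iterD E0 lt; set c := Config 48 r m.
have E : agree 11 r (reg (run 2 c)) by do 11?[case=> [|] //].
have E11 : reg (run 2 c) rnext = r rnext + r 6 by reflexivity.
have E12 : reg (run 2 c) rroot = r rroot by reflexivity.
have E13 : reg (run 2 c) rcur = r rnext + r rzero by reflexivity.
have Em : memory (run 2 c) = m by reflexivity.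
have Epc : pc (run 2 c) = test_label by reflexivity.
case: (run 2 c) E E11 E12 E13 Em Epc => l r' m' /= E; rewrite c0 c6 addn0 => E11 E12 E13 -> ->.
by exists r'.
Qed.

Lemma run_last_vertex r m : r rend <= r rnext ->
  run 1 (Config next_label r m) = Config finish_label r m.
Proof.
move=> le; have -> : run 1 (Config next_label r m) =
  Config (if r rend <= r rnext then finish_label else 48) r m by reflexivity.
by rewrite le.
Qed.

Lemma run_test r m : constants r -> exists t r', [/\ t <= 3,
  run t (Config test_label r m) =
    Config (if m (r rcur) == 1 then absorb_label else next_label) r' m &
  agree 15 r r'].
Proof.
move=> [_ c2 _ _ [_ _ c0]]; set c := Config test_label r m.
have E2 : agree 15 r (reg (run 2 c)) by do 15?[case=> [|] //].
have Em2 : memory (run 2 c) = m by reflexivity.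
have Epc2 : pc (run 2 c) = if m (r rcur) <= r rzero then next_label else 52 by reflexivity.
have E15 : reg (run 2 c) 15 = m (r rcur) by reflexivity.
case: (leqP (m (r rcur)) 0) => d0.
  exists 2, (reg (run 2 c)); split=> //.
  case: (run 2 c) Em2 Epc2 {E2 E15} => l r' m' /= -> ->; rewrite c0 d0.
  by have -> : (m (r rcur) == 1) = false by lia.
exists 3, (reg (run 2 c)); split=> //; rewrite -[3]/(1 + 2) iterD.
have E2' := E2 2 isT; case: (run 2 c) E2' E15 Em2 Epc2 {E2} => l r' m' /= E2 E15 -> ->.
rewrite c0 leqNgt d0 /=.
have -> : step eop_program (Config 52 r' m) =
  Config (if r' 2 <= r' 15 then next_label else absorb_label) r' m by reflexivity.
rewrite E2 c2 E15; congr Config.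
by case: (m (r rcur)) d0 => [|[|k]].
Qed.

Lemma run_finish r m d s t : constants r -> stored m (r rroot) d s t ->
  outcome eop_program 10 (maxn (maxn (t Outside) (t Centre)) (t Leaf)) (Config finish_label r m).
Proof.
move=> [c1 c2 c3 c4 [c5 c6 c0]] [_ _ m2 m3 [_ m5]]; split; first by reflexivity.
set q := r 12.
have -> : reg (run 10 (Config finish_label r m)) 0 =
  let x := m (q + r 2) + (m (q + r 3) - m (q + r 2)) in x + (m (q + r 5) - x) by reflexivity.
by rewrite /= c2 c3 c5 m2 m3 m5 !maxnE.
Qed.

(** * Correctness and running time *)

Opaque eop_program.

Lemma agree_constants k r r' : 7 < k -> agree k r r' -> constants r -> constants r'.
Proof.
by move=> lt A; rewrite /constants !A //; apply: leq_trans lt.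
Qed.

(** Bounds both the time spent on reading the input and the room it takes. *)
Lemma size_edge_list n (T : sgraph 'I_n) (l : seq ('I_n * 'I_n)) :
  acyclic T -> edge_list T l -> size l <= n.
Proof.
move=> acy el; have := forest_degree_sum [set: 'I_n] acy.
rewrite cardsT card_ord; under eq_bigr do rewrite /degree -(edge_list_sum _ _ el).
rewrite exchange_big /= => le; rewrite -(leq_pmul2l (isT : 0 < 2)); apply: leq_trans le.
rewrite -sum1_size big_distrr /=; apply: leq_sum => e _.
rewrite (bigD1 e.1 (in_setT _)) /= eqxx.
case: (eqVneq e.2 e.1) => [_|ne]; first by lia.
have P2 : (e.2 \in [set: 'I_n]) && (e.2 != e.1) by rewrite in_setT.
by rewrite (bigD1 e.2 P2) /= eqxx; lia.
Qed.

Lemma agree_leq k k' r r' : k <= k' -> agree k' r r' -> agree k r r'.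
Proof. by move=> le A i lt; apply: A; apply: leq_trans le. Qed.

Lemma agree_trans k k' r r' r'' :
  k' <= k -> agree k r r' -> agree k' r' r'' -> agree k' r r''.
Proof. by move=> le A A' i lt; rewrite A' ?A // (leq_trans lt). Qed.

Definition machine_ready n r :=
  [/\ constants r, r rbase = n * 2 + 3 & r rend = n * 2 + 3 + n * 6].

Lemma agree_ready n r r' : agree rnext r r' -> machine_ready n r -> machine_ready n r'.
Proof.
move=> A [c b e]; split; first exact: agree_constants A c.
  exact: etrans (A rbase isT) b.
exact: etrans (A rend isT) e.
Qed.

Section Reading.

Variables (n : nat) (l : seq ('I_n * 'I_n)).
Let base := n * 2 + 3.

Definition ptr (x : 'I_n) := base + x * 6.

Definition incidence (g : 'I_n -> nat) (s : seq ('I_n * 'I_n)) x :=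
  \sum_(e <- s) ((e.1 == x) * g e.2 + (e.2 == x) * g e.1).

Definition tallied (m : nat -> nat) s := forall x : 'I_n,
  stored m (ptr x) (incidence (fun=> 1) s x) (incidence ptr s x) (fun=> 0).

Lemma nth_encode (l1 l2 : seq ('I_n * 'I_n)) i :
  nth 0 (encode (l1 ++ l2)) (size l1 * 2 + 1 + i) =
  nth 0 (flatten [seq [:: val uv.1; val uv.2] | uv <- l2]) i.
Proof.
rewrite /encode map_cat flatten_cat addn1 addSn /= nth_cat.
have -> : size (flatten [seq [:: val uv.1; val uv.2] | uv <- l1]) = size l1 * 2.
  by elim: l1 => //= e l1 ->; rewrite mulSn.
by rewrite ltnNge leq_addr addKn.
Qed.

Lemma tallied_rcons m m' s u w : u != w -> tallied m s ->
    m' (ptr u) = m (ptr u) + 1 -> m' (ptr u + 1) = m (ptr u + 1) + ptr w ->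
    m' (ptr w) = m (ptr w) + 1 -> m' (ptr w + 1) = m (ptr w + 1) + ptr u ->
    (forall a, (forall x, x = u \/ x = w -> a != ptr x /\ a != ptr x + 1) -> m' a = m a) ->
  tallied m' (rcons s (u, w)).
Proof.
move=> ne ts hu hu1 hw hw1 ho x; have [t0 t1 t2 t3 [t4 t5]] := ts x.
have inc g : incidence g (rcons s (u, w)) x =
    incidence g s x + ((u == x) * g w + (w == x) * g u).
  by rewrite /incidence -cats1 big_cat big_seq1.
have far i : 1 < i <= 5 -> m' (ptr x + i) = m (ptr x + i).
  by move=> hi; apply: ho => y _; rewrite /ptr; lia.
rewrite /stored !inc (far 2) // (far 3) // (far 4) // (far 5) //; split=> //.
- case: (eqVneq u x) => [e|ux]; first by subst x; rewrite eq_sym (negbTE ne) hu t0.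
  case: (eqVneq w x) => [e|wx]; first by subst x; rewrite hw t0.
  rewrite ho ?t0 ?addn0 // => y [] ->; move: ux wx; rewrite -!val_eqE /ptr /=; lia.
- case: (eqVneq u x) => [e|ux]; first by subst x; rewrite eq_sym (negbTE ne) hu1 t1; lia.
  case: (eqVneq w x) => [e|wx]; first by subst x; rewrite hw1 t1; lia.
  rewrite ho ?t1 ?addn0 // => y [] ->; move: ux wx; rewrite -!val_eqE /ptr /=; lia.
Qed.

Hypothesis nloop : forall e, e \in l -> e.1 != e.2.
Hypothesis size_l : size l <= n.

(** An edge costs 8 steps to read and 23 to store; the last 8 steps read the two
    zeros that end the list. *)
Lemma run_edges l2 : forall l1 r m, l = l1 ++ l2 -> machine_ready n r ->
    r rnext = size l1 * 2 + 1 ->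
    (forall a, a < base -> m a = nth 0 (encode l) a) -> tallied m l1 ->
  exists r' m', [/\ run (size l2 * 31 + 8) (Config edge_label r m) = Config prune_label r' m',
    machine_ready n r' & tallied m' l].
Proof.
elim: l2 => [|[u w] l2 IH] l1 r m lE ready rx mE tl; have [cr rb re] := ready.
  have m0 i : i < 2 -> m (r rnext + i) = 0.
    move=> i2; rewrite mE ?rx; first by rewrite lE nth_encode nth_nil.
    by move: size_l; rewrite /base lE size_cat /=; lia.
  have m00 : m (r rnext) = 0 by rewrite -[r rnext]addn0 m0.
  have [r' [-> A _ _ _]] := run_read_edge cr m00 (m0 1 isT).
  exists r', m; rewrite eqxx; split=> //; last by rewrite lE cats0.
  exact: agree_ready A ready.
have size12 : size l1 + (size l2).+1 <= n by move: size_l; rewrite lE size_cat.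
have mu : m (r rnext) = u.
  by rewrite mE rx; [rewrite -[_ + 1]addn0 lE nth_encode | rewrite /base; lia].
have mw : m (r rnext + 1) = w.
  by rewrite mE rx; [rewrite lE nth_encode | rewrite /base; lia].
have ne : u != w by apply: (nloop (e := (u, w))); rewrite lE mem_cat mem_head orbT.
have [r1 [R1 A1 x1 u1 w1]] := run_read_edge cr mu mw.
rewrite (negbTE (ne : (u : nat) != w)) in R1.
have cr1 := agree_constants (isT : 7 < 11) A1 cr.
have [r2 [m2 [R2 A2 [hu hu1] [hw hw1] ho]]] :=
  run_store_edge m cr1 (etrans (A1 9 isT) rb) u1 w1 ne.
have -> : size ((u, w) :: l2) * 31 + 8 = (size l2 * 31 + 8) + (23 + 8) by rewrite /=; lia.
rewrite iterD [run (23 + 8) _]iterD R1 R2.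
apply: (IH (rcons l1 (u, w))).
- by rewrite cat_rcons.
- exact: agree_ready (agree_trans _ A1 (agree_leq _ A2)) ready.
- by rewrite (A2 rnext isT) x1 rx size_rcons; lia.
- move=> a lt; rewrite ho; first exact: mE.
  by move=> x _; clear -lt; lia.
- apply: (tallied_rcons ne tl hu hu1 hw hw1) => a H; apply: ho => x [] ->; apply: H; auto.
Qed.

End Reading.

Section Pruning.

Variables (n : nat) (T : sgraph 'I_n).
Hypotheses (acy : acyclic T) (con : forall x y, connect T x y).

(** The invariant of the pruning: the memory describes the forest induced on [R],
    and the table of each remaining vertex is exact for the block that it has
    absorbed. The degree zero of a removed vertex stops the scan from using the
    rest of its record, which is stale. *)
Record pruned (m : nat -> nat) (R : {set 'I_n}) own tab : Prop := Pruned {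
  pruned_contraction : contraction T R own;
  pruned_optima : forall w, w \in R -> optima T (block own w) w (tab w);
  pruned_stored : forall w, w \in R ->
    stored m (ptr w) (degree T R w) (nbr_sum T (@ptr n) R w) (tab w);
  pruned_zero : forall w, w \notin R -> m (ptr w) = 0
}.

Lemma nbr_sum_absorb (R : {set 'I_n}) v p g w : v \in R -> w != v -> w != p ->
  (forall y, y \in R -> T v y -> y = p) -> w \in R ->
  nbr_sum T g (R :\ v) w = nbr_sum T g R w.
Proof.
move=> vR wv wp pu wR; rewrite (nbr_sumD1 _ _ _ vR).
case wv': (T w v) => //; rewrite adj_sym in wv'.
by rewrite (pu _ wR wv') eqxx in wp.
Qed.

(** Only the unique neighbour [p] of the removed leaf [v] sees a change. *)
Lemma pruned_absorb m m' R own tab v p :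
  pruned m R own tab -> v \in R -> p \in R -> T v p ->
  (forall y, y \in R -> T v y -> y = p) ->
  m' (ptr v) = 0 ->
  stored m' (ptr p) (degree T R p - 1) (nbr_sum T (@ptr n) R p - ptr v)
    (attach (tab p) (tab v)) ->
  (forall a, a != ptr v -> a < ptr p \/ ptr p + 5 < a -> m' a = m a) ->
  pruned m' (R :\ v) (redirect own v p)
    (fun w => if w == p then attach (tab p) (tab v) else tab w).
Proof.
move=> [c o s z] vR pR vp pu mv mp mo.
have pv : p != v by rewrite eq_sym (adj_neq vp).
have drop g : nbr_sum T g (R :\ v) p = nbr_sum T g R p - g v.
  by rewrite (nbr_sumD1 _ _ _ vR) adj_sym vp mul1n addKn.
have far w i : i <= 5 -> w != p -> w != v -> m' (ptr w + i) = m (ptr w + i).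
  by move=> i5 wp wv; apply: mo; move: wp wv; rewrite -!val_eqE /ptr /=; lia.
split.
- exact: contraction_redirect.
- exact: optima_redirect.
- move=> w; rewrite in_setD1 => /andP[wv wR]; case: (eqVneq w p) => [->|wp].
    by rewrite /degree !drop.
  rewrite /degree !(nbr_sum_absorb _ vR wv wp pu wR) /stored !far //.
  by rewrite -[ptr w]addn0 far // addn0; apply: s.
- move=> w; rewrite in_setD1 negb_and negbK; case: (eqVneq w v) => [-> _|wv /= wR] //.
  by rewrite -[ptr w]addn0 far ?addn0 ?z //; apply: contraNneq wR => ->.
Qed.

(** All vertices below the scan position [i], except possibly the current vertex
    [v], are known not to be leaves. An absorption removes a vertex and hands the
    exception over to the neighbour, the only remaining vertex whose degree has
    changed; any other step moves the scan on. So [#|R| + (n - i)] decreases, and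
    the time is linear in it. When the scan is over no leaf is left, hence one block is the
    whole tree; the root register holds its root, since the last absorbing
    vertex always remains. *)
Lemma outcome_prune k : forall r m (R : {set 'I_n}) own tab (v q : 'I_n) i,
    #|R| + (n - i) < k -> machine_ready n r -> pruned m R own tab ->
    q \in R -> r rroot = ptr q -> r rcur = ptr v ->
    i <= n -> r rnext = n * 2 + 3 + i * 6 ->
    (forall w : 'I_n, w \in R -> w < i -> w != v -> degree T R w != 1) ->
  outcome eop_program (#|R| * 51 + (n - i) * 6 + 14) (eop_number T) (Config test_label r m).
Proof.
elim: k => // k IH r m R own tab v q i ltk ready pr qR rq rv i_n ri sw.
have [cr rb re] := ready.
have [c o s z] := pr.
have [t [r1 [t3 R1 A1]]] := run_test m cr; rewrite rv in R1.
have cr1 := agree_constants (isT : 7 < 15) A1 cr.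
have ready1 := agree_ready (agree_leq (isT : 11 <= 15) A1) ready.
(* Absorbing takes 3 + 48 steps with its test, moving on 3 + 3, ending 3 + 1 + 10. *)
case: (eqVneq (m (ptr v)) 1) R1 => [mv1|mv1] R1.
  have vR : v \in R by apply: contraT => /z; rewrite mv1.
  have [dv sv] : degree T R v = 1 /\ stored m (ptr v) 1 (nbr_sum T (@ptr n) R v) (tab v).
    by have := s v vR; case=> d0 *; rewrite -d0 mv1.
  have [p [pR vp pu pE]] := leaf_nbr dv; rewrite pE in sv.
  have pv : p != v by rewrite eq_sym (adj_neq vp).
  have rv1 : r1 rcur = ptr v by rewrite (A1 rcur isT).
  rewrite -rv1 in sv.
  have dis : r1 rcur < ptr p \/ ptr p + 5 < r1 rcur.
    by rewrite rv1; move: pv; rewrite -val_eqE /ptr /=; lia.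
  have [r2 [m2 [R2 A2 [cur2 root2] [z2 st2] o2]]] := run_absorb cr1 sv (s p pR) dis.
  rewrite rv1 in st2 z2 o2.
  have pr2 := pruned_absorb pr vR pR vp pu z2 st2 o2.
  have cardR : #|R| = (#|R :\ v|).+1 by rewrite (cardsD1 v R) vR.
  apply: (@outcome_leq _ (t + (48 + (#|R :\ v| * 51 + (n - i) * 6 + 14)))).
    by rewrite cardR; lia.
  apply: outcome_iter; rewrite R1; apply: outcome_iter; rewrite R2.
  apply: (IH _ _ _ _ _ p p i) pr2 _ root2 cur2 i_n _ _.
  - by move: ltk; rewrite cardR addSn ltnS.
  - exact: agree_ready (agree_leq _ A2) ready1.
  - by rewrite in_setD1 pv.
  - by rewrite (A2 rnext isT) (A1 rnext isT).
  - move=> w; rewrite in_setD1 => /andP[wv wR] wi wp.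
    by rewrite /degree (nbr_sum_absorb _ vR wv wp pu wR); apply: sw.
have swi w : w \in R -> w < i -> degree T R w != 1.
  case: (eqVneq w v) => [->|ne wR wi]; last exact: sw.
  by move=> wR' _; have [<- *] := s v wR'.
case: (ltnP i n) => [lt|ge]; last first.
  have full : block own q = [set: 'I_n].
    by apply: (contraction_done acy con c qR) => w wR; apply: swi wR (leq_trans (ltn_ord w) ge).
  have oq := o q qR; rewrite full in oq; rewrite (eop_number_root oq).
  apply: (@outcome_leq _ (t + (1 + 10))); first by lia.
  apply: outcome_iter; rewrite R1; apply: outcome_iter.
  rewrite run_last_vertex; last by rewrite (A1 rend isT) (A1 rnext isT) re ri; lia.
  by apply: run_finish cr1 _; rewrite (A1 rroot isT) rq; apply: s.
have lt1 : r1 rnext < r1 rend.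
  by rewrite (A1 rend isT) (A1 rnext isT) re ri; lia.
have [r2 [R2 A2 cur2 next2 root2]] := run_next_vertex m cr1 lt1.
apply: (@outcome_leq _ (t + (3 + (#|R| * 51 + (n - i.+1) * 6 + 14)))); first by lia.
apply: outcome_iter; rewrite R1; apply: outcome_iter; rewrite R2.
apply: (IH _ _ _ _ _ (Ordinal lt) q i.+1) pr qR _ _ _ _ _ => //.
- by lia.
- exact: agree_ready A2 ready1.
- by rewrite root2 (A1 rroot isT).
- by rewrite cur2 (A1 rnext isT) ri.
- by rewrite next2 (A1 rnext isT) ri; lia.
- move=> w wR wi ne; apply: swi wR _; rewrite ltn_neqAle -ltnS wi andbT.
  exact: ne.
Qed.

End Pruning.

Theorem theorem3p6 :
  exists (P : program) (C : nat),
    forall (n : nat) (T : sgraph 'I_n) (l : seq ('I_n * 'I_n)),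
      is_tree T -> edge_list T l ->
      outputs_within P (encode l) (C * n) (eop_number T).
Proof.
exists eop_program, 200 => n T l [n0 con acy] el; rewrite card_ord in n0.
have nloop e : e \in l -> e.1 != e.2.
  move=> le; apply: (adj_neq (G := T)); rewrite -mem_edges -mem_enum -(perm_mem el).
  exact: (map_f (fun uv : 'I_n * 'I_n => [set uv.1; uv.2])).
have size_l := size_edge_list acy el.
have [r0 [R0 c0 b0 e0 x0]] := run_setup (encode l).
have ready0 : machine_ready n r0 by split; rewrite ?e0 ?b0.
have far (x : 'I_n) i : nth 0 (encode l) (ptr x + i) = 0.
  have -> : ptr x + i = size l * 2 + 1 + (ptr x + i - (size l * 2 + 1)).
    by rewrite /ptr; lia.
  by rewrite -{1}[l]cats0 nth_encode nth_nil.
have t0 : tallied (nth 0 (encode l)) ([::] : seq ('I_n * 'I_n)).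
  by move=> x; rewrite /stored /incidence !big_nil !far -[ptr x]addn0 far.
have [r1 [m1 [R1 ready1 t1]]] :=
  run_edges (l1 := [::]) nloop size_l (erefl l) ready0 x0
    (fun a _ => erefl) t0.
have [c1 b1 e1] := ready1.
have [r2 [R2 A2 x2 q2]] := run_prune m1 c1.
have c2 := agree_constants (isT : 7 < 11) A2 c1.
have lt2 : r2 rnext < r2 rend by rewrite x2 (A2 rend isT) e1 b1; lia.
have [r3 [R3 A3 v3 x3 q3]] := run_next_vertex m1 c2 lt2.
pose first := Ordinal n0.
have pr : pruned T m1 [set: 'I_n] id (fun _ _ => 0).
  split.
  - exact: contraction_id.
  - move=> w _; rewrite (_ : block id w = [set w]); first exact: optima_set1.
    by apply/setP => x; rewrite !inE.
  - by move=> w _; rewrite /degree -!(edge_list_sum _ w el); apply: t1.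
  - by move=> w; rewrite inE.
have fin : outcome eop_program (#|[set: 'I_n]| * 51 + (n - 1) * 6 + 14) (eop_number T)
    (Config test_label r3 m1).
  apply: (outcome_prune acy con (q := first) (v := first) (i := 1) (ltnSn _)) pr _ _ _ _ _ _ => //.
  - exact: agree_ready A3 (agree_ready A2 ready1).
  - by rewrite in_setT.
  - by rewrite q3 q2 b1 /ptr addn0.
  - by rewrite v3 x2 b1 /ptr addn0.
  - by rewrite x3 x2 b1.
  - by move=> w _; rewrite ltnS leqn0 -val_eqE /= => /eqP ->.
apply: (@outcome_leq _ (14 + ((size l * 31 + 8) + (2 + (3 +
  (#|[set: 'I_n]| * 51 + (n - 1) * 6 + 14)))))).
  by rewrite cardsT card_ord; lia.
apply: outcome_iter; rewrite R0; apply: outcome_iter; rewrite R1.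
by apply: outcome_iter; rewrite R2; apply: outcome_iter; rewrite R3.
Qed.
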